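(* Let $\mathbb{G}=(\Gamma,\mathcal{G})$ be a graph of groups such that $|\Sigma_e|\geq2$ for any $e\in E(\Gamma)$. Suppose there exists a vertex $v\in V(\Gamma)$ emitting infinitely many edges, i.e. there are infinitely many different $e_i\in E(\Gamma)$, $i\in\mathbb{N}$, with $o(e_i)=v$. Suppose that for any finite set $F\subset G_v\setminus\{1_v\}$ and finite $E\subset\{e\in E(\Gamma):o(e)=v\}$ there exists an edge $f$ with $o(f)=v$ such that $f\notin E$ and $g\notin\alpha_f(G_f)$ for any $g\in F$. Then $\pi_1(\mathbb{G},v)\curvearrowright\partial_\infty X_{\mathbb{G}}$ is strongly faithful.
   Context: A graph $\Gamma$ has a vertex set $V(\Gamma)$, a set $E(\Gamma)$ of oriented edges, maps $o,t:E(\Gamma)\to V(\Gamma)$ and an involution $e\mapsto\bar e$ with $\bar e\ne e$ and $o(e)=t(\bar e)$. A graph of groups $\mathbb{G}=(\Gamma,\mathcal{G})$ is a connected graph $\Gamma$ with vertex groups $G_v$, edge groups $G_e=G_{\bar e}$, and monomorphisms $\alpha_e:G_e\hookrightarrow G_{o(e)}$; $\Gamma$ is countable and all groups are countable discrete. For each $e$, $\Sigma_e\subset G_{o(e)}$ is a fixed set of representatives of the left cosets $G_{o(e)}/\alpha_e(G_e)$ containing the identity. The path group $F(\mathbb{G})$ is generated by all $G_v$ and all $e\in E(\Gamma)$ subject to $\bar e=e^{-1}$ and $\bar e\,\alpha_e(g)\,e=\alpha_{\bar e}(g)$ for $g\in G_e$. $\pi[v,u]\subset F(\mathbb{G})$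 is the set of elements $g_1e_1\cdots g_ne_ng_{n+1}$ ($n\ge 0$) with $(e_1,\dots,e_n)$ an edge path from $v$ to $u$, $g_i\in G_{o(e_i)}$, $g_{n+1}\in G_u$; $\pi_1(\mathbb{G},v)=\pi[v,v]$. The Bass–Serre tree $X_{\mathbb{G}}$ has vertices the cosets $\gamma G_u$, $\gamma\in\pi[v,u]$, $u\in V(\Gamma)$; $\gamma_1G_{u_1}$, $\gamma_2G_{u_2}$ are joined by an edge iff $\gamma_1^{-1}\gamma_2\in G_{u_1}eG_{u_2}$ for some $e$ with $o(e)=u_1$, $t(e)=u_2$; $\pi_1(\mathbb{G},v)$ acts by left multiplication. $\partial_\infty X_{\mathbb{G}}$ is the set of geodesic rays in $X_{\mathbb{G}}$ modulo cofinality (eventual coincidence), with the induced action. An action $G\curvearrowright S$ on a set $S$ is strongly faithful if for any finite $F\subset G\setminus\{1_G\}$ there is $x\in S$ with $g\cdot x\ne x$ for all $g\in F$. *)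

(* Defs.v *)
From HB Require Import structures.
From mathcomp Require Import all_boot.
From mathcomp Require Import boolp classical_sets functions cardinality.

Set Implicit Arguments.
Unset Strict Implicit.
Unset Printing Implicit Defensive.

Local Open Scope classical_set_scope.
Local Open Scope group_scope.
Local Open Scope quotient_scope.

Record action (G : groupType) (S : Type) := Action {
  act :> G -> S -> S;
  act1 : forall x, act 1 x = x;
  actM : forall g h x, act (g * h) x = act g (act h x) }.

Definition strongly_faithful (G : groupType) (S : Type) (a : action G S) :=
  forall F : set G, finite_set F -> F `<=` [set~ 1] ->
    exists x : S, forall g, F g -> a g x <> x.

(* Rays and boundary of the graph with vertex set T and adjacency adj. *)
Section Boundary.
Variables (T : choiceType) (adj : T -> T -> Prop).

Definition walk (n : nat) (x y : T) := exists p : nat -> T,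
  [/\ p 0%N = x, p n = y & forall i, (i < n)%N -> adj (p i) (p i.+1)].

Definition geodesic_ray (r : nat -> T) :=
  (forall i, adj (r i) (r i.+1)) /\
  (forall i j n, (i <= j)%N -> walk n (r i) (r j) -> (j - i <= n)%N).

Definition ray := {r : nat -> T | `[< geodesic_ray r >]}.

Definition cofinal (r s : ray) : Prop :=
  exists m n : nat, forall k, val r (m + k)%N = val s (n + k)%N.

Definition cofinalb (r s : ray) : bool := `[< cofinal r s >].

Lemma cofinalb_refl : reflexive cofinalb.
Proof. by move=> r; apply/asboolP; exists 0%N, 0%N. Qed.

Lemma cofinalb_sym : symmetric cofinalb.
Proof.
by move=> r s; apply/asboolP/asboolP => -[m [n E]]; exists n, m => k; rewrite E.
Qed.

Lemma cofinalb_trans : transitive cofinalb.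
Proof.
move=> s r t /asboolP[m [n E]] /asboolP[m' [n' E']]; apply/asboolP.
exists (m + m')%N, (n' + n)%N => k.
by rewrite -addnA E addnCA E' addnA.
Qed.

Canonical cofinal_equiv :=
  EquivRel cofinalb cofinalb_refl cofinalb_sym cofinalb_trans.

Definition boundary := {eq_quot cofinalb}.

Section Induced.
Variables (G : groupType) (a : action G T).
Hypothesis a_adj : forall g x y, adj x y -> adj (a g x) (a g y).

Lemma act_walk g n x y : walk n x y -> walk n (a g x) (a g y).
Proof.
move=> [p [p0 pn pP]]; exists (a g \o p); split=> /=; rewrite ?p0 ?pn //.
by move=> i /pP /(a_adj g).
Qed.

Lemma act_geodesic g (r : ray) : `[< geodesic_ray (a g \o val r) >].
Proof.
case: r => r /= /asboolP[r_adj r_geo]; apply/asboolP; split=> /=.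
  by move=> i; apply: a_adj.
move=> i j n ij /(act_walk g^-1); rewrite -!actM mulVg !act1; exact: r_geo.
Qed.

Definition ray_act (g : G) (r : ray) : ray := Sub (a g \o val r) (act_geodesic g r).

Definition boundary_fun (g : G) (xi : boundary) : boundary :=
  \pi_boundary (ray_act g (repr xi)).

Lemma boundary_funE g (r : ray) :
  boundary_fun g (\pi_boundary r) = \pi_boundary (ray_act g r).
Proof.
apply/eqmodP => /=.
have /eqmodP/asboolP[m [n E]] : repr (\pi_boundary r) = r %[mod boundary].
  by rewrite reprK.
by apply/asboolP; exists m, n => k /=; rewrite E.
Qed.

Lemma boundary_fun1 xi : boundary_fun 1 xi = xi.
Proof.
elim/quotW: xi => r; rewrite boundary_funE; congr (\pi_boundary _).
by apply: val_inj; apply/funext => i /=; rewrite act1.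
Qed.

Lemma boundary_funM g h xi :
  boundary_fun (g * h) xi = boundary_fun g (boundary_fun h xi).
Proof.
elim/quotW: xi => r; rewrite (boundary_funE h r) (boundary_funE (g * h) r).
rewrite boundary_funE; congr (\pi_boundary _).
by apply: val_inj; apply/funext => i /=; rewrite actM.
Qed.

Definition boundary_act := Action boundary_fun1 boundary_funM.

End Induced.
End Boundary.

Record graph := Graph {
  vertex : countType;
  edge : countType;
  orig : edge -> vertex;
  term : edge -> vertex;
  bar : edge -> edge;
  barK : involutive bar;
  bar_neq : forall e, bar e != e;
  orig_term : forall e, orig e = term (bar e) }.

Arguments orig {g} e.
Arguments term {g} e.
Arguments bar {g} e.

Fixpoint edge_path (Gamma : graph) (u : vertex Gamma) (p : seq (edge Gamma))
    (w : vertex Gamma) : bool :=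
  if p is e :: p' then (orig e == u) && edge_path (term e) p' w else u == w.

Definition connected (Gamma : graph) :=
  forall u w : vertex Gamma, exists p, edge_path u p w.

Record graph_of_groups := GraphOfGroups {
  base :> graph;
  base_connected : connected base;
  vgroup : vertex base -> groupType;
  egroup : edge base -> groupType;
  egroup_bar : forall e, egroup e = egroup (bar e);
  alpha : forall e, {multiplicative egroup e -> vgroup (orig e)};
  alpha_inj : forall e, injective (alpha e);
  vgroup_countable : forall u, countable [set: vgroup u];
  egroup_countable : forall e, countable [set: egroup e] }.

Arguments vgroup {g} u.
Arguments egroup {g} e.
Arguments alpha {g} e.

(* the identity map G_e -> G_{bar e} *)
Definition egroup_cast (GG : graph_of_groups) (e : edge GG) (g : egroup e) :
    egroup (bar e) :=
  eq_rect _ (fun H : groupType => H : Type) g _ (egroup_bar e).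

(* s lies in the left coset g alpha_e(G_e) iff s^-1 * g \in alpha_e(G_e). *)
Definition coset_reps (GG : graph_of_groups) (e : edge GG)
    (Sigma : set (vgroup (orig e))) :=
  Sigma 1 /\
  forall g, exists! s, Sigma s /\ range (alpha e) (s^-1 * g).

(* g \in alpha_f(G_f), for g \in G_u; only inhabited when o(f) = u, and the
   equality in the total space avoids a transport along o(f) = u. *)
Definition in_edge_image (GG : graph_of_groups) (f : edge GG)
    (u : vertex GG) (g : vgroup u) :=
  exists h : egroup f, Tagged (@vgroup GG) (alpha f h) = Tagged (@vgroup GG) g.

Section PathGroup.
Variable GG : graph_of_groups.

Definition letter : Type := ({u : vertex GG & vgroup u} + edge GG)%type.
Definition vletter (u : vertex GG) (g : vgroup u) : letter :=
  inl (Tagged (@vgroup GG) g).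
Definition eletter (e : edge GG) : letter := inr e.

(* The congruence on words generated by the multiplication tables of the vertex
   groups and by the relations of the path group. The quotient monoid is already
   a group, since every letter is invertible in it. *)
Inductive path_rel : seq letter -> seq letter -> Prop :=
| path_rel_refl w : path_rel w w
| path_rel_sym w w' : path_rel w w' -> path_rel w' w
| path_rel_trans w w' w'' : path_rel w w' -> path_rel w' w'' -> path_rel w w''
| path_rel_cat w1 w1' w2 w2' :
    path_rel w1 w1' -> path_rel w2 w2' -> path_rel (w1 ++ w2) (w1' ++ w2')
| path_rel_one (u : vertex GG) : path_rel [:: vletter (1 : vgroup u)] [::]
| path_rel_mul (u : vertex GG) (g h : vgroup u) :
    path_rel [:: vletter g; vletter h] [:: vletter (g * h)]
| path_rel_bar (e : edge GG) : path_rel [:: eletter e; eletter (bar e)] [::]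
| path_rel_conj (e : edge GG) (g : egroup e) :
    path_rel [:: eletter (bar e); vletter (alpha e g); eletter e]
             [:: vletter (alpha (bar e) (egroup_cast g))].

Definition path_relb (w w' : seq letter) : bool := `[< path_rel w w' >].

Lemma path_relb_refl : reflexive path_relb.
Proof. by move=> w; apply/asboolP; exact: path_rel_refl. Qed.

Lemma path_relb_sym : symmetric path_relb.
Proof. by move=> w w'; apply/asboolP/asboolP; exact: path_rel_sym. Qed.

Lemma path_relb_trans : transitive path_relb.
Proof.
by move=> w' w w'' /asboolP E /asboolP E'; apply/asboolP/(path_rel_trans E E').
Qed.

Canonical path_rel_equiv :=
  EquivRel path_relb path_relb_refl path_relb_sym path_relb_trans.

Definition path_group := {eq_quot path_relb}.
HB.instance Definition _ := Choice.on path_group.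

Definition letter_inv (l : letter) : letter :=
  match l with
  | inl (existT u g) => vletter (g^-1)
  | inr e => eletter (bar e)
  end.

Definition word_inv (w : seq letter) : seq letter := rev (map letter_inv w).

Lemma word_inv_cat w w' : word_inv (w ++ w') = word_inv w' ++ word_inv w.
Proof. by rewrite /word_inv map_cat rev_cat. Qed.

Lemma letter_invV l : path_rel [:: letter_inv l; l] [::].
Proof.
case: l => [[u g]|e] /=.
  apply: (path_rel_trans (path_rel_mul _ _)); rewrite mulVg.
  exact: path_rel_one.
by rewrite -[X in [:: _; inr X]]barK; exact: path_rel_bar.
Qed.

Lemma letter_invr l : path_rel [:: l; letter_inv l] [::].
Proof.
case: l => [[u g]|e] /=; last exact: path_rel_bar.
apply: (path_rel_trans (path_rel_mul _ _)); rewrite mulgV.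
exact: path_rel_one.
Qed.

Lemma word_invV w : path_rel (word_inv w ++ w) [::].
Proof.
elim: w => [|l w IH]; first exact: path_rel_refl.
rewrite -cat1s word_inv_cat -catA (catA _ [:: l]).
apply: path_rel_trans IH; apply: path_rel_cat; first exact: path_rel_refl.
rewrite -[X in path_rel _ X]cat0s; apply: path_rel_cat; last exact: path_rel_refl.
exact: letter_invV.
Qed.

Lemma word_invr w : path_rel (w ++ word_inv w) [::].
Proof.
elim/last_ind: w => [|w l IH]; first exact: path_rel_refl.
rewrite -cats1 word_inv_cat -catA (catA [:: l]).
apply: path_rel_trans IH; apply: path_rel_cat; first exact: path_rel_refl.
rewrite -[X in path_rel _ X]cat0s; apply: path_rel_cat; last exact: path_rel_refl.
exact: letter_invr.
Qed.

Definition path_group_one : path_group := \pi_path_group [::].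
Definition path_group_mul (x y : path_group) : path_group :=
  \pi_path_group (repr x ++ repr y).
Definition path_group_inv (x : path_group) : path_group :=
  \pi_path_group (word_inv (repr x)).

Lemma path_repr w : path_rel (repr (\pi_path_group w)) w.
Proof.
have /eqmodP/asboolP // : repr (\pi_path_group w) = w %[mod path_group].
by rewrite reprK.
Qed.

Lemma path_pi w w' : path_rel w w' -> \pi_path_group w = \pi_path_group w'.
Proof. by move=> E; apply/eqmodP/asboolP. Qed.

Lemma path_group_mulE w w' :
  path_group_mul (\pi_path_group w) (\pi_path_group w') =
    \pi_path_group (w ++ w').
Proof. by apply: path_pi; apply: path_rel_cat; exact: path_repr. Qed.

Lemma path_groupP (x : path_group) : exists w, x = \pi_path_group w.
Proof. by exists (repr x); rewrite reprK. Qed.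

Fact path_group_mulA : associative path_group_mul.
Proof.
move=> x y z; have [a ->] := path_groupP x; have [b ->] := path_groupP y.
by have [c ->] := path_groupP z; rewrite !path_group_mulE catA.
Qed.

Fact path_group_mul1 : left_id path_group_one path_group_mul.
Proof. by move=> x; have [w ->] := path_groupP x; rewrite path_group_mulE. Qed.

Fact path_group_mulr1 : right_id path_group_one path_group_mul.
Proof.
by move=> x; have [w ->] := path_groupP x; rewrite path_group_mulE cats0.
Qed.

Fact path_group_mulV :
  left_inverse path_group_one path_group_inv path_group_mul.
Proof.
move=> x; rewrite /path_group_inv -{2}[x]reprK path_group_mulE.
exact/path_pi/word_invV.
Qed.

Fact path_group_mulrV :
  right_inverse path_group_one path_group_inv path_group_mul.
Proof.
move=> x; rewrite /path_group_inv -{1}[x]reprK path_group_mulE.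
exact/path_pi/word_invr.
Qed.

HB.instance Definition _ := isGroup.Build path_group
  path_group_mulA path_group_mul1 path_group_mulr1
  path_group_mulV path_group_mulrV.

Definition vgen (u : vertex GG) (g : vgroup u) : path_group :=
  \pi_path_group [:: vletter g].
Definition egen (e : edge GG) : path_group := \pi_path_group [:: eletter e].

(* pi[v, u] *)
Inductive path_set : vertex GG -> vertex GG -> path_group -> Prop :=
| path_set_nil (u : vertex GG) (g : vgroup u) : path_set u u (vgen g)
| path_set_cons (e : edge GG) (u : vertex GG) (g : vgroup (orig e)) x :
    path_set (term e) u x -> path_set (orig e) u (vgen g * egen e * x).

Lemma vgenM (u : vertex GG) (g h : vgroup u) : vgen (g * h) = vgen g * vgen h.
Proof.
apply/esym/(etrans (path_group_mulE _ _)); exact/path_pi/path_rel_mul.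
Qed.

Lemma vgen1 (u : vertex GG) : vgen (1 : vgroup u) = 1.
Proof. exact/path_pi/path_rel_one. Qed.

Lemma vgenV (u : vertex GG) (g : vgroup u) : vgen g^-1 = (vgen g)^-1.
Proof. by apply: (@mulgI _ (vgen g)); rewrite -vgenM !mulgV vgen1. Qed.

Lemma egenV (e : edge GG) : egen (bar e) = (egen e)^-1.
Proof.
apply: (@mulgI _ (egen e)); rewrite mulgV.
apply: etrans (path_group_mulE _ _) _; exact/path_pi/path_rel_bar.
Qed.

Lemma path_set_vgenM (u w : vertex GG) (g : vgroup u) x :
  path_set u w x -> path_set u w (vgen g * x).
Proof.
move=> ux; case: ux g => [u' h|e w' h y yP] g.
  by rewrite -vgenM; exact: path_set_nil.
by rewrite !mulgA -vgenM; exact: path_set_cons.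
Qed.

Lemma path_setM (u v w : vertex GG) x y :
  path_set u v x -> path_set v w y -> path_set u w (x * y).
Proof.
move=> ux; elim: ux y => [v' g|e v' g x' _ IH] y yP; first exact: path_set_vgenM.
by rewrite -mulgA; apply: path_set_cons; exact: IH.
Qed.

Lemma path_set1 (u : vertex GG) : path_set u u 1.
Proof. by rewrite -(vgen1 u); exact: path_set_nil. Qed.

Lemma path_setV (u v : vertex GG) x : path_set u v x -> path_set v u x^-1.
Proof.
elim=> [w g|e w g y _ IH]; first by rewrite -vgenV; exact: path_set_nil.
rewrite !invgM; apply: path_setM IH _.
rewrite -vgenV -egenV -[egen _]mul1g -(vgen1 (orig (bar e))).
rewrite -[term e](congr1 term (barK e)) -orig_term.
apply: path_set_cons.
by rewrite -orig_term; exact: path_set_nil.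
Qed.

(* x G_u *)
Definition coset (u : vertex GG) (x : path_group) : set path_group :=
  [set x * vgen g | g in [set: vgroup u]].

Section BassSerre.
Variable v : vertex GG.

Definition pi1_pred : {pred path_group} := fun x => `[< path_set v v x >].

Lemma pi1_group_closed : group_closed pi1_pred.
Proof.
split; first by apply/asboolP; exact: path_set1.
move=> x y /asboolP xP /asboolP yP; apply/asboolP.
by apply: path_setM xP _; exact: path_setV.
Qed.

Definition pi1 := {x : path_group | x \in pi1_pred}.
HB.instance Definition _ := SubChoice.on pi1.
HB.instance Definition _ := SubChoice_isSubGroup.Build path_group
  (fun x => x \in pi1_pred) pi1 pi1_group_closed.

Definition is_bs_vertex (A : set path_group) :=
  exists u x, path_set v u x /\ A = coset u x.

Definition bs_vertex := {A : set path_group | `[< is_bs_vertex A >]}.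

Definition bs_adj (A B : bs_vertex) :=
  exists (e : edge GG) (x y : path_group),
    [/\ path_set v (orig e) x, path_set v (term e) y,
        val A = coset (orig e) x, val B = coset (term e) y &
        exists (g : vgroup (orig e)) (h : vgroup (term e)),
          x^-1 * y = vgen g * egen e * vgen h].

Lemma translate_coset (u : vertex GG) (z x : path_group) :
  [set z * y | y in coset u x] = coset u (z * x).
Proof.
apply/seteqP; split=> y.
  by move=> [_ [g _ <-] <-]; exists g; rewrite // mulgA.
by move=> [g _ <-]; exists (x * vgen g); rewrite ?mulgA //; exists g.
Qed.

Lemma translate_vertex (z : pi1) (A : bs_vertex) :
  `[< is_bs_vertex [set val z * y | y in val A] >].
Proof.
case: z A => z /= /asboolP zP [A /= /asboolP[u [x [xP ->]]]]; apply/asboolP.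
exists u, (z * x); split; last exact: translate_coset.
exact: path_setM zP xP.
Qed.

Definition bs_fun (z : pi1) (A : bs_vertex) : bs_vertex :=
  Sub [set val z * y | y in val A] (translate_vertex z A).

Lemma bs_fun1 A : bs_fun 1 A = A.
Proof.
apply: val_inj; apply/seteqP; split=> y /=; first by move=> [x xA <-]; rewrite mul1g.
by move=> yA; exists y; rewrite ?mul1g.
Qed.

Lemma bs_funM z w A : bs_fun (z * w) A = bs_fun z (bs_fun w A).
Proof.
apply: val_inj; apply/seteqP; split=> y /=.
  by move=> [x xA <-]; exists (val w * x); rewrite ?mulgA //; exists x.
by move=> [_ [x xA <-] <-]; exists x; rewrite ?mulgA.
Qed.

Definition bs_act : action pi1 bs_vertex := Action bs_fun1 bs_funM.

Lemma bs_act_adj z A B : bs_adj A B -> bs_adj (bs_act z A) (bs_act z B).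
Proof.
have zP : path_set v v (val z) by apply/asboolP; exact: (valP z).
move=> [e [x [y [xP yP Ax By [g [h xy]]]]]].
exists e, (val z * x), (val z * y); split; rewrite /= ?Ax ?By ?translate_coset //.
- exact: path_setM zP xP.
- exact: path_setM zP yP.
- by exists g, h; rewrite invgM -mulgA mulKg.
Qed.

Definition bs_boundary := boundary bs_adj.

Definition bs_boundary_act : action pi1 bs_boundary := boundary_act bs_act_adj.

End BassSerre.
End PathGroup.

(* Main.v *)
From HB Require Import structures.
Require Import Defs.
From mathcomp Require Import all_boot.
From mathcomp Require Import boolp classical_sets functions cardinality.

(** The boundary point is the end of a zigzag ray. Every edge e has some b_e in
    G_{o(e)} outside the image of G_e, because there are at least two cosets.
    For an edge f leaving v, the word
      f b_{bar f} bar f b_f f b_{bar f} bar f b_f ...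
    has no backtracking, so its prefixes x_0, x_1, x_2, ... run through the
    vertices of a geodesic ray from G_v. Given a finite set F of nontrivial
    elements, f is chosen so that neither f nor bar f occurs in a fixed word for
    an element of F, and so that the image of G_f contains no element of F that
    lies in G_v. If g in F fixed the end of the ray, then x_n^-1 g x_m would lie
    in a vertex group for some m, n > 0. But this element reads
    ... bar f g f ..., where no cancellation is possible around g: either g has
    a normal form with edges, all different from f and bar f, or g lies in G_v
    and outside the image of G_f. So its length is at least n, which is absurd
    (zigzag_move_size).

    Both the geodesicity of the ray and the last step need a length on the path
    group for which words without backtracking have full length, that is, a
    normal form theorem. It is obtained by van der Waerden's method, with a
    device that removes all compatibility conditions between letters. Let P be
    the product of all vertex groups. Each edge e gives an isomorphism between
    the copies in P of the images of G_e in G_{o(e)} and in G_{t(e)}, and the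
    path group maps to the HNN extension of P with the edges as stable letters.
    Normal forms of this extension are words p e_1 s_1 ... e_n s_n with p in P
    arbitrary and s_i a representative of a right coset, so that multiplication
    by a letter on the left only changes the beginning of the word. The path
    group acts on these words (act_word_rel), and one edge letter changes n by
    at most one. That bounds the length of x^-1 y by the distance in the
    Bass-Serre tree (walk_size), while every letter of a word without
    backtracking lengthens the normal form (act_edge_grow).

    The map to the HNN extension is only needed to be faithful at one point: an
    element of pi[v, v] whose normal form has no edges lies in G_v. This holds
    because the normal form of an element of pi[w, u] is again a path from w,
    with entries in the right vertex groups, and multiplies back to that element
    (normal_form_realizes). *)

Set Implicit Arguments.
Unset Strict Implicit.
Unset Printing Implicit Defensive.

Local Open Scope classical_set_scope.
Local Open Scope card_scope.
Local Open Scope group_scope.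

(** * The product of the vertex groups and its edge isomorphisms *)

Definition vprod (GG : graph_of_groups) := forall u : vertex GG, vgroup u.

Section VertexProduct.
Variable GG : graph_of_groups.
Implicit Types (p q : vprod GG).

Definition vprod_one : vprod GG := fun=> 1.
Definition vprod_mul p q : vprod GG := fun u => p u * q u.
Definition vprod_inv p : vprod GG := fun u => (p u)^-1.

Fact vprod_mulA : associative vprod_mul.
Proof. by move=> p q r; apply: functional_extensionality_dep => u; exact: mulgA. Qed.
Fact vprod_mul1 : left_id vprod_one vprod_mul.
Proof. by move=> p; apply: functional_extensionality_dep => u; exact: mul1g. Qed.
Fact vprod_mulr1 : right_id vprod_one vprod_mul.
Proof. by move=> p; apply: functional_extensionality_dep => u; exact: mulg1. Qed.
Fact vprod_mulV : left_inverse vprod_one vprod_inv vprod_mul.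
Proof. by move=> p; apply: functional_extensionality_dep => u; exact: mulVg. Qed.
Fact vprod_mulrV : right_inverse vprod_one vprod_inv vprod_mul.
Proof. by move=> p; apply: functional_extensionality_dep => u; exact: mulgV. Qed.

HB.instance Definition _ :=
  Choice.copy (vprod GG) (forall u : vertex GG, vgroup u).
HB.instance Definition _ := isGroup.Build (vprod GG)
  vprod_mulA vprod_mul1 vprod_mulr1 vprod_mulV vprod_mulrV.

Definition vin (u : vertex GG) (g : vgroup u) : vprod GG := fun w =>
  if pselect (u = w) is left E then eq_rect u (@vgroup GG) g w E else 1.

Lemma vin_self (u : vertex GG) (g : vgroup u) : vin g u = g.
Proof.
rewrite /vin; case: pselect => // E.
by rewrite (Prop_irrelevance E erefl).
Qed.

Lemma vin_inj (u : vertex GG) : injective (@vin u).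
Proof. by move=> g h E; rewrite -(vin_self g) E vin_self. Qed.

Lemma vin_out (u w : vertex GG) (g : vgroup u) : u <> w -> vin g w = 1.
Proof. by rewrite /vin; case: pselect. Qed.

Lemma vinM (u : vertex GG) (g h : vgroup u) : vin (g * h) = vin g * vin h.
Proof.
apply: functional_extensionality_dep => w.
have [<-|uw] := pselect (u = w); first
  by rewrite vin_self /mul/= /vprod_mul !vin_self.
by rewrite vin_out // /mul/= /vprod_mul !vin_out // mulg1.
Qed.

Lemma vin1 (u : vertex GG) : vin (1 : vgroup u) = 1.
Proof. by apply: (mulgI (vin (1 : vgroup u))); rewrite -vinM !mulg1. Qed.

Lemma vinV (u : vertex GG) (g : vgroup u) : vin g^-1 = (vin g)^-1.
Proof. by apply: (mulgI (vin g)); rewrite -vinM !mulgV vin1. Qed.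

Lemma vin_transport (u w : vertex GG) (g : vgroup u) : u = w ->
  exists h : vgroup w, vin h = vin g /\ vgen h = vgen g.
Proof. by move=> <-; exists g. Qed.

Lemma vin_eq_tagged (u w : vertex GG) (g : vgroup u) (h : vgroup w) :
  u = w -> vin g = vin h -> Tagged (@vgroup GG) g = Tagged (@vgroup GG) h.
Proof. by move=> E; case: w / E h => h /vin_inj ->. Qed.

(** Casting G_e to G_{bar e} and then to G_{bar (bar e)} is a transport along a
    loop, hence the identity since proofs of an equality are equal. *)
Lemma eq_rect_groupK (e e' : edge GG) (H1 : egroup e = egroup e')
    (H2 : egroup e' = egroup e) (c : egroup e) :
  eq_rect _ (fun H : groupType => H : Type)
    (eq_rect _ (fun H : groupType => H : Type) c _ H1) _ H2 = c.
Proof.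
move: c; case: _ / H1 H2 => H2 c /=.
by rewrite (Prop_irrelevance H2 erefl).
Qed.

(** The isomorphism between the two images of G_e in the product, as a relation,
    which avoids choosing values outside these images. *)
Definition edge_iso (e : edge GG) (a b : vprod GG) :=
  exists c : egroup e,
    a = vin (alpha e c) /\ b = vin (alpha (bar e) (egroup_cast c)).

Lemma egroup_castM (e : edge GG) : {morph @egroup_cast GG e : c d / c * d}.
Proof. by rewrite /egroup_cast; case: _ / (egroup_bar e). Qed.

Lemma edge_iso_bar (e : edge GG) a b : edge_iso e a b -> edge_iso (bar e) b a.
Proof.
move=> [c [-> ->]]; exists (egroup_cast c); split=> //.
suff H (e' : edge GG) (E : e = e') (H1 : egroup e = egroup (bar e))
    (H2 : egroup (bar e) = egroup e') :
  vin (alpha e c) = vin (alpha e' (eq_rect _ (fun H : groupType => H : Type)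
    (eq_rect _ (fun H : groupType => H : Type) c _ H1) _ H2)).
  by apply: H; rewrite barK.
by case: e' / E H2 => H2; rewrite eq_rect_groupK.
Qed.

Lemma edge_iso_barK (e : edge GG) a b : edge_iso (bar e) a b -> edge_iso e b a.
Proof. by move=> /edge_iso_bar; rewrite barK. Qed.

Lemma edge_isoM e a b a' b' :
  edge_iso e a b -> edge_iso e a' b' -> edge_iso e (a * a') (b * b').
Proof.
move=> [c [-> ->]] [d [-> ->]]; exists (c * d).
by rewrite egroup_castM !gmulfM !vinM.
Qed.

Lemma edge_iso_fun e a b b' : edge_iso e a b -> edge_iso e a b' -> b = b'.
Proof. by move=> [c [-> ->]] [d [/vin_inj/alpha_inj -> ->]]. Qed.

Lemma alpha1 (e : edge GG) : alpha e 1 = 1.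
Proof. by apply: (mulgI (alpha e 1)); rewrite -gmulfM !mulg1. Qed.

Lemma alphaV (e : edge GG) (c : egroup e) : alpha e c^-1 = (alpha e c)^-1.
Proof. by apply: (mulgI (alpha e c)); rewrite -gmulfM !mulgV alpha1. Qed.

Lemma egroup_cast1 (e : edge GG) : egroup_cast (1 : egroup e) = 1.
Proof. by rewrite /egroup_cast; case: _ / (egroup_bar e). Qed.

Lemma egroup_castV (e : edge GG) : {morph @egroup_cast GG e : c / c^-1}.
Proof. by rewrite /egroup_cast; case: _ / (egroup_bar e). Qed.

Lemma edge_iso1 e : edge_iso e 1 1.
Proof. by exists 1; rewrite egroup_cast1 !alpha1 !vin1. Qed.

Lemma edge_isoV e a b : edge_iso e a b -> edge_iso e a^-1 b^-1.
Proof.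
by move=> [c [-> ->]]; exists c^-1; rewrite egroup_castV !alphaV !vinV.
Qed.

End VertexProduct.

(** * Normal forms and the action of the path group *)

Section NormalForms.
Variable GG : graph_of_groups.
Implicit Types (e : edge GG) (p q a b s : vprod GG).

Definition eimage e a := exists b, edge_iso e a b.

Lemma eimage1 e : eimage e 1. Proof. by exists 1; exact: edge_iso1. Qed.

Lemma eimageM e a b : eimage e a -> eimage e b -> eimage e (a * b).
Proof. by move=> [a' ha] [b' hb]; exists (a' * b'); exact: edge_isoM. Qed.

Lemma eimageV e a : eimage e a -> eimage e a^-1.
Proof. by move=> [a' ha]; exists a'^-1; exact: edge_isoV. Qed.

Lemma eimage_mulr e p a : eimage e a -> eimage e (p * a) -> eimage e p.
Proof. by move=> ha hpa; rewrite -(mulgK a p); apply/eimageM/eimageV. Qed.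

Lemma eimage_mull e p a : eimage e a -> eimage e (a * p) -> eimage e p.
Proof.
by move=> ha hpa; rewrite -(mulKg a p); apply/eimageM => //; exact/eimageV.
Qed.

Lemma edge_iso_eimage e a b : edge_iso e a b -> eimage e a.
Proof. by exists b. Qed.

(** A representative of the right coset of p modulo the image of G_e, equal to 1
    on the trivial coset. *)
Definition rep e p : vprod GG :=
  if `[< eimage e p >] then 1 else xget 1 [set q | eimage e (p * q^-1)].

Lemma repP e p : eimage e (p * (rep e p)^-1).
Proof.
rewrite /rep; case: asboolP => [|_]; first by rewrite invg1 mulg1.
apply: (@xgetPex _ _ [set q | eimage e (p * q^-1)]).
by exists p; rewrite /= mulgV; exact: eimage1.
Qed.

Lemma rep_mull e a p : eimage e a -> rep e (a * p) = rep e p.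
Proof.
move=> ha; have E q : eimage e (a * q) = eimage e q.
  by apply/propext; split; [exact: eimage_mull | exact: eimageM].
rewrite /rep E; congr (if _ then _ else xget _ _).
by apply/seteqP; split=> q /=; rewrite -mulgA E.
Qed.

Lemma rep1 e : rep e 1 = 1.
Proof. by rewrite /rep asboolT //; exact: eimage1. Qed.

Lemma rep_idem e p : rep e (rep e p) = rep e p.
Proof. by rewrite -{2}(mulgVK (rep e p) p) (rep_mull _ (repP e p)). Qed.

(** The pair (p, [:: (e_1, s_1); ...; (e_n, s_n)]) stands for the word
    p e_1 s_1 ... e_n s_n. *)
Definition state := (vprod GG * seq (edge GG * vprod GG))%type.
Definition base_state : state := (1, [::]).

(** In the word e s e_1 s_1 ..., the first two edges cancel. *)
Definition cancels e s (L : seq (edge GG * vprod GG)) : bool :=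
  if L is (e', _) :: _ then (s == 1) && (e' == bar e) else false.

(** Normal forms. On arbitrary states, the actions of e and bar e need not be
    inverse to each other. *)
Fixpoint valid (L : seq (edge GG * vprod GG)) : Prop :=
  if L is (e, s) :: L' then [/\ rep (bar e) s = s, ~~ cancels e s L' & valid L']
  else True.

(** The normal form of b e s L; when e s e_1 cancels, the first representative
    of L is absorbed into b. *)
Definition prepend b e s L : state :=
  if cancels e s L then (b * (head (e, 1) L).2, behead L) else (b, (e, s) :: L).

(** Writing p = a s with a in the image of G_{bar e}, e p = b e s for the
    element b of the image of G_e that corresponds to a. *)
Definition act_edge e (S : state) : state :=
  let s := rep (bar e) S.1 in
  prepend (xget 1 [set b | edge_iso (bar e) (S.1 * s^-1) b]) e s S.2.

Lemma act_edgeE e a b s L : edge_iso e b a -> rep (bar e) s = s ->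
  act_edge e (a * s, L) = prepend b e s L.
Proof.
move=> /edge_iso_bar ba sP.
rewrite /act_edge /= (rep_mull _ (edge_iso_eimage ba)) sP mulgK.
congr prepend; apply: (@edge_iso_fun _ (bar e) a) => //.
by apply: (@xgetPex _ _ [set x | edge_iso (bar e) a x]); exists b.
Qed.

Lemma edge_decomp e p : exists a b s,
  [/\ p = a * s, edge_iso e b a & rep (bar e) s = s].
Proof.
have [b gl] := repP (bar e) p.
exists (p * (rep (bar e) p)^-1), b, (rep (bar e) p); split.
- by rewrite mulgVK.
- exact: edge_iso_barK.
- exact: rep_idem.
Qed.

Definition act_left p (S : state) : state := (p * S.1, S.2).

Lemma act_left_valid p S : valid S.2 -> valid (act_left p S).2.
Proof. by []. Qed.

Lemma act_edge_left e a b S : edge_iso e b a ->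
  act_edge e (act_left a S) = act_left b (act_edge e S).
Proof.
case: S => p L ba; have [a' [b' [s [-> ba' sP]]]] := edge_decomp e p.
rewrite /act_left /= mulgA (act_edgeE _ (edge_isoM ba ba') sP).
rewrite (act_edgeE _ ba' sP).
by rewrite /prepend; case: cancels; rewrite //= mulgA.
Qed.

Lemma act_edge_valid e S : valid S.2 -> valid (act_edge e S).2.
Proof.
case: S => p L; have [a [b [s [-> ba sP]]]] := edge_decomp e p.
rewrite (act_edgeE _ ba sP) /prepend; case cs: (cancels e s L) => /=.
  by case: L cs => [|[e' s'] L] //= _ [].
by rewrite sP cs.
Qed.

(** If bar e cancels the first edge of the word, then validity guarantees that
    the following edge does not cancel in turn when e is put back; if it is
    added, then e cancels it. *)
Lemma act_edge_bar e S : valid S.2 -> act_edge e (act_edge (bar e) S) = S.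
Proof.
case: S => p L; have [a [b [s [-> ba sP]]]] := edge_decomp (bar e) p.
have ab := edge_iso_barK ba.
rewrite (act_edgeE _ ba sP) /prepend /=; case cs: (cancels (bar e) s L).
  case: L cs => [|[e' s'] L] //= /andP[/eqP s1]; rewrite barK => /eqP->.
  move=> [s'P ncs _].
  by rewrite (act_edgeE _ ab s'P) /prepend (negbTE ncs) s1 mulg1.
move=> _; rewrite -[b]mulg1 (act_edgeE _ ab); last exact: rep1.
by rewrite /prepend /= !eqxx.
Qed.

Definition act_letter (l : letter GG) (S : state) : state :=
  match l with
  | inl (existT u g) => act_left (vin g) S
  | inr e => act_edge e S
  end.

Definition act_word (w : seq (letter GG)) (S : state) : state :=
  foldr act_letter S w.

Lemma act_word_valid w S : valid S.2 -> valid (act_word w S).2.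
Proof. by move=> vS; elim: w => [|[[u g]|e] w IH] //=; exact: act_edge_valid. Qed.

Lemma act_leftM p q S : act_left (p * q) S = act_left p (act_left q S).
Proof. by rewrite /act_left /= mulgA. Qed.

Lemma act_left1 S : act_left 1 S = S.
Proof. by case: S => p L; rewrite /act_left mul1g. Qed.

(** Van der Waerden's argument: the defining relations of the path group hold
    in the action on normal forms, so its elements act on them. *)
Lemma act_word_rel w w' S : path_rel w w' -> valid S.2 ->
  act_word w S = act_word w' S.
Proof.
move=> ww' ; elim: ww' S => {w w'}
  [w|w w' _ IH|w w' w'' _ IH _ IH'|w1 w1' w2 w2' _ IH _ IH'|u|u g h|e|e c] //= S vS.
- by rewrite IH.
- by rewrite IH ?IH'.
- rewrite /act_word !foldr_cat -/(act_word w2 _) IH' //.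
  by apply: IH; exact: act_word_valid.
- by rewrite vin1 act_left1.
- by rewrite vinM act_leftM.
- by rewrite act_edge_bar.
- rewrite -(@act_edge_left e (vin (alpha (bar e) (egroup_cast c))));
    last by exists c.
  by rewrite -{2}[e]barK act_edge_bar.
Qed.

Definition act_elt (x : path_group GG) : state -> state := act_word (repr x).

Lemma act_elt_pi w S : valid S.2 ->
  act_elt (\pi_(path_group GG)%qT w) S = act_word w S.
Proof. by move=> vS; apply: act_word_rel vS; exact: path_repr. Qed.

Lemma act_elt_valid x S : valid S.2 -> valid (act_elt x S).2.
Proof. exact: act_word_valid. Qed.

Lemma act_eltM x y S : valid S.2 -> act_elt (x * y) S = act_elt x (act_elt y S).
Proof.
move=> vS; rewrite /(x * y) /= act_elt_pi //.
by rewrite /act_word foldr_cat.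
Qed.

Lemma act_elt_vgen (u : vertex GG) (g : vgroup u) S : valid S.2 ->
  act_elt (vgen g) S = act_left (vin g) S.
Proof. by move=> vS; rewrite act_elt_pi. Qed.

Lemma act_elt_egen e S : valid S.2 -> act_elt (egen e) S = act_edge e S.
Proof. by move=> vS; rewrite act_elt_pi. Qed.

Lemma act_elt1 S : valid S.2 -> act_elt 1 S = S.
Proof. by move=> vS; rewrite act_elt_pi. Qed.

(** The only way for e p e_1 s_1 ... to be shorter is that e_1 = bar e and p
    lies in the image of G_{bar e}. The new head lies in the image of G_e, so
    that multiplying it by an element outside this image prepares the next
    letter bar e to lengthen the word again. *)
Lemma act_edge_grow e p L :
  ~ (eimage (bar e) p /\ ohead (unzip1 L) = Some (bar e)) ->
  exists b s, eimage e b /\ act_edge e (p, L) = (b, (e, s) :: L).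
Proof.
have [a [b [s [-> ba sP]]]] := edge_decomp e p => nc.
exists b, s; split; first exact: edge_iso_eimage ba.
rewrite (act_edgeE _ ba sP) /prepend; case: ifP => // cs; case: nc.
case: L cs => [|[e' s'] L] //= /andP[/eqP-> /eqP->]; split=> //.
by rewrite mulg1; exact: edge_iso_eimage (edge_iso_bar ba).
Qed.

Lemma size_act_edge e S : (size (act_edge e S).2 <= (size S.2).+1)%N.
Proof.
rewrite /act_edge /prepend; case: ifP => //= _; rewrite size_behead.
exact: leq_trans (leq_pred _) _.
Qed.

Definition word_edges (w : seq (letter GG)) : seq (edge GG) :=
  pmap (fun l => if l is inr e then Some e else None) w.

Lemma act_edge_cat e f s L0 p L :
  bar e != f ->
  act_edge e (p, L ++ (f, s) :: L0) =
    ((act_edge e (p, L)).1, (act_edge e (p, L)).2 ++ (f, s) :: L0).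
Proof.
have [a [b [t [-> ba tP]]]] := edge_decomp e p => bf.
rewrite !(act_edgeE _ ba tP) /prepend.
case: L => [|[e' s'] L] /=; last by case: ifP.
by rewrite (eq_sym f) (negbTE bf) andbF.
Qed.

Lemma act_edge_avoid e f S : e != f ->
  f \notin unzip1 S.2 -> f \notin unzip1 (act_edge e S).2.
Proof.
move=> ef; rewrite /act_edge /prepend; case: ifP => _ /=.
  by apply: contra; case: S.2 => [|x L] //=; rewrite inE orbC => ->.
by rewrite inE negb_or eq_sym ef.
Qed.

(** A word without the letters f and bar f never reaches the part of a normal
    form that begins with f: its edges cannot cancel that f. *)
Lemma act_word_cat w f s L0 p L :
  {in word_edges w, forall e, (e != f) && (bar e != f)} ->
  f \notin unzip1 L ->
  act_word w (p, L ++ (f, s) :: L0) =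
    ((act_word w (p, L)).1, (act_word w (p, L)).2 ++ (f, s) :: L0)
  /\ f \notin unzip1 (act_word w (p, L)).2.
Proof.
move=> + fL; elim: w => [|l w IH] //= wf.
have {}/IH[-> IH] : {in word_edges w, forall e, (e != f) && (bar e != f)}.
  by move=> e ew; apply: wf; case: l => //= e'; rewrite inE ew orbT.
case: l wf => [[u g]|e] wf //=.
have /andP[ef bf] := wf e (mem_head _ _).
by rewrite act_edge_cat //= -surjective_pairing; split=> //; exact: act_edge_avoid.
Qed.

End NormalForms.

(** * Normal forms of paths multiply back to the path *)

Section Realization.
Variable GG : graph_of_groups.
Implicit Types (e : edge GG) (u w : vertex GG) (x y : path_group GG).

Lemma egen_alpha e (c : egroup e) :
  egen e * vgen (alpha (bar e) (egroup_cast c)) = vgen (alpha e c) * egen e.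
Proof.
have <- : egen (bar e) * (vgen (alpha e c) * egen e) =
          vgen (alpha (bar e) (egroup_cast c)).
  rewrite [vgen _ * _]path_group_mulE.
  apply: etrans (path_group_mulE _ _) _.
  exact/path_pi/path_rel_conj.
by rewrite egenV mulVKg.
Qed.

(** Elements of the product of the vertex groups have no meaning in the path
    group; a state whose entries follow a path in the graph can nevertheless be
    multiplied out there. *)
Fixpoint realizes w (g : vgroup w) (L : seq (edge GG * vprod GG)) x : Prop :=
  if L is (e, q) :: L' then
    orig e = w /\ exists (s : vgroup (term e)) (y : path_group GG),
      [/\ q = vin s, x = vgen g * egen e * y & realizes s L' y]
  else x = vgen g.

Lemma realizes_mull w (h g : vgroup w) L x :
  realizes g L x -> realizes (h * g) L (vgen h * x).
Proof.
case: L => [->|[e q] L] /=; first by rewrite vgenM.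
by move=> [ow [s [y [qs -> sy]]]]; split=> //; exists s, y; rewrite vgenM !mulgA.
Qed.

Lemma realizes_transport w w' (g : vgroup w) L x : w = w' -> realizes g L x ->
  exists g' : vgroup w', vin g' = vin g /\ realizes g' L x.
Proof. by move=> <-; exists g. Qed.

Lemma term_bar e : term e = orig (bar e).
Proof. by rewrite orig_term barK. Qed.

(** Left multiplication by g e keeps a normal form within the vertex groups of
    the path: if t = a s with a in the image of G_{bar e}, then s lies in the
    same vertex group as t, and moving a across e uses only a relation of the
    path group. *)
Lemma normal_form_realizes w u x : path_set w u x ->
  exists (g : vgroup w) L,
    realizes g L x /\ act_elt x (base_state GG) = (vin g, L).
Proof.
elim=> {w u x} [u g|e u g x _ [t [L [tx xE]]]].
  by exists g, [::]; rewrite act_elt_vgen // /act_left /= mulg1.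
have vL : valid L by have := @act_elt_valid GG x (base_state GG) I; rewrite xE.
have [a [b [s [ta ba sP]]]] := edge_decomp e (vin t).
have [c [bE aE]] := ba.
have [a' [a'E a'v]] :=
  vin_transport (alpha (bar e) (egroup_cast c)) (esym (term_bar e)).
rewrite aE -a'E in ta ba.
have sE : s = vin (a'^-1 * t) by rewrite vinM vinV ta mulKg.
have gE : act_elt (vgen g * egen e * x) (base_state GG) =
    act_left (vin g) (prepend b e s L).
  rewrite !act_eltM ?xE // act_elt_egen // act_elt_vgen; last exact: act_edge_valid.
  by rewrite ta (act_edgeE _ ba sP).
rewrite {}gE /prepend; case: ifP => cs; last first.
  exists (g * alpha e c), ((e, s) :: L); rewrite /act_left /= bE vinM; split=> //.
  split=> //; exists (a'^-1 * t), (vgen a'^-1 * x); split=> //.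
    rewrite vgenM -(mulgA (vgen g) (vgen _) (egen e)) -egen_alpha -a'v vgenV.
    rewrite -!mulgA.
    by rewrite mulVKg.
  exact: realizes_mull.
case: L cs tx {xE vL} => [|[e' q] L] //= /andP[/eqP s1 /eqP->].
move=> [_ [t' [y [-> -> t'y]]]].
have [t2 [t2E t2y]] := realizes_transport (esym (orig_term e)) t'y.
exists (g * alpha e c * t2), L; rewrite /act_left /= bE !vinM t2E.
split; last by rewrite mulgA.
suff -> : vgen g * egen e * (vgen t * egen (bar e) * y) =
    vgen (g * alpha e c) * y.
  exact: realizes_mull.
have -> : t = a'.
  by apply: vin_inj; rewrite ta s1 mulg1.
rewrite a'v vgenM !mulgA -(mulgA (vgen g) (egen e)) egen_alpha.
by rewrite egenV !mulgA mulgK.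
Qed.

Lemma realizes_nil w u x p : path_set w u x ->
  act_elt x (base_state GG) = (p, [::]) -> exists g : vgroup w, x = vgen g.
Proof.
by move=> /normal_form_realizes[g [L [gx ->]]] [_ L0]; exists g; rewrite L0 in gx.
Qed.

Lemma vgen_inj w : injective (@vgen GG w).
Proof.
move=> g h E; apply: vin_inj.
have: act_elt (vgen g) (base_state GG) = act_elt (vgen h) (base_state GG).
  by rewrite E.
by rewrite !act_elt_vgen // /act_left /= !mulg1 => -[].
Qed.

Lemma eimage_in_edge_image f w (g : vgroup w) : orig f = w ->
  eimage f (vin g) -> in_edge_image f g.
Proof. by move=> fw [_ [c [gE _]]]; exists c; apply: vin_eq_tagged. Qed.

(** The head k need not be 1: in front of its first edge f, the normal form of a
    zigzag word carries an element of the image of G_f, and this is the head on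
    which x acts when what follows is set aside. *)
Lemma loop_vgen w x (k : vgroup w) : path_set w w x ->
  (act_elt x (vin k, [::])).2 = [::] -> exists g : vgroup w, x = vgen g.
Proof.
move=> xP; case E: (act_elt x _) => [p L] /= L0; rewrite {}L0 in E.
have [||g gE] := @realizes_nil w w (x * vgen k) p.
- by apply: path_setM xP _; exact: path_set_nil.
- by rewrite act_eltM // act_elt_vgen // /act_left /= mulg1.
by exists (g * k^-1); rewrite vgenM vgenV -gE mulgK.
Qed.

End Realization.

(** * Normal forms bound distances in the Bass-Serre tree *)

Ltac solve_valid := repeat match goal with
  | |- valid (act_edge _ _).2 => apply: act_edge_valid
  | |- valid (act_left _ _).2 => apply: act_left_valid
  | |- valid (act_elt _ _).2 => apply: act_elt_valid
  end; solve [assumption | exact I].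

#[local] Hint Extern 0 (valid _) => solve_valid : core.

Section Tree.
Variables (GG : graph_of_groups) (v : vertex GG).
Implicit Types (A B : bs_vertex v) (x y z : path_group GG).

Lemma coset_refl u x : coset u x x.
Proof. by exists 1; rewrite ?vgen1 ?mulg1. Qed.

Lemma coset_div u z x y : coset u z x -> coset u z y ->
  exists g : vgroup u, x^-1 * y = vgen g.
Proof.
move=> [g _ <-] [h _ <-]; exists (g^-1 * h).
by rewrite invgM -mulgA mulKg vgenM vgenV.
Qed.

Lemma bs_vertex_div A x y : val A x -> val A y ->
  exists u (g : vgroup u), x^-1 * y = vgen g.
Proof.
have [u [z [_ ->]]] : is_bs_vertex v (val A) by apply/asboolP; exact: (valP A).
by move=> Ax Ay; exists u; exact: coset_div Ax Ay.
Qed.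

Lemma bs_adj_div A B x y : bs_adj A B -> val A x -> val B y ->
  exists e (g : vgroup (orig e)) (h : vgroup (term e)),
    x^-1 * y = vgen g * egen e * vgen h.
Proof.
move=> [e [a [b [_ _ -> -> [g [h ab]]]]]] xa yb.
have [g' g'E] := coset_div xa (coset_refl _ _).
have [h' h'E] := coset_div (coset_refl _ _) yb.
exists e, (g' * g), (h * h').
have -> : x^-1 * y = (x^-1 * a) * (a^-1 * b) * (b^-1 * y).
  by rewrite -!mulgA !mulVKg.
by rewrite g'E ab h'E !vgenM !mulgA.
Qed.

(** Along a walk of length n, x^-1 y is a product of elements of vertex groups
    and n edges, and only the edges can lengthen a normal form. *)
Lemma walk_size n A B x y (st : state GG) :
  walk (@bs_adj GG v) n A B -> val A x -> val B y -> valid st.2 ->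
  (size (act_elt (x^-1 * y)%g st).2 <= size st.2 + n)%N.
Proof.
move=> [p [p0 + padj]] xA yB vS; rewrite -{}p0 in xA.
elim: n p padj x xA => [|n IH] p padj x xA pn.
  rewrite -pn in yB; have [u [g ->]] := bs_vertex_div xA yB.
  by rewrite act_elt_vgen // addn0.
have [u [z [_ pE]]] : is_bs_vertex v (val (p 1%N)).
  by apply/asboolP; exact: (valP (p 1%N)).
have z1 : val (p 1%N) z by rewrite pE; exact: coset_refl.
have [e [g [h E]]] := bs_adj_div (padj 0%N isT) xA z1.
have {IH} := IH (p \o S) (fun i => padj i.+1) z z1 pn.
have -> : x^-1 * y = (x^-1 * z) * (z^-1 * y) by rewrite -mulgA mulVKg.
rewrite {}E => IH; rewrite act_eltM //.
move: (act_elt _ st) (@act_elt_valid _ (z^-1 * y) st vS) IH => st' vst' st'n.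
rewrite !act_eltM ?act_elt_vgen ?act_elt_egen //.
by rewrite addnS; apply: leq_trans (size_act_edge _ _) _.
Qed.

End Tree.

(** * Zigzag words *)

Section Zigzag.
Variables (GG : graph_of_groups) (b : forall e : edge GG, vgroup (orig e)).
Hypothesis b_notin : forall e, ~ eimage e (vin (b e)).

Fixpoint zigzag (e : edge GG) (d : nat) : path_group GG :=
  if d is d'.+1 then egen e * vgen (b (bar e)) * zigzag (bar e) d' else 1.

Lemma zigzagD e i d : zigzag e (i + d) = zigzag e i * zigzag (iter i bar e) d.
Proof. by elim: i e => [|i IH] e; rewrite ?mul1g // iterSr addSn /= IH !mulgA. Qed.

Lemma path_set_step e :
  path_set (orig e) (orig (bar e)) (egen e * vgen (b (bar e))).
Proof.
rewrite -[egen e]mul1g -(vgen1 (orig e)); apply: path_set_cons.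
by rewrite term_bar; exact: path_set_nil.
Qed.

Lemma path_set_zigzag e d : path_set (orig e) (orig (iter d bar e)) (zigzag e d).
Proof.
elim: d e => [|d IH] e; first exact: path_set1.
by rewrite iterSr; apply: path_setM (path_set_step e) (IH _).
Qed.

(** That the head lies in the image of G_e is what makes the induction work:
    multiplied by b, it leaves this image, so the next edge does not cancel. *)
Lemma zigzag_state e d : exists p L,
  [/\ act_elt (zigzag e d) (base_state GG) = (p, L), size L = d, eimage e p &
      (0 < d)%N -> exists s L', L = (e, s) :: L'].
Proof.
elim: d e => [|d IH] e.
  by exists 1, [::]; rewrite act_elt1 //; split=> //; exact: eimage1.
have [p [L [E sL pe _]]] := IH (bar e).
have vL : valid L.
  by have := @act_elt_valid _ (zigzag (bar e) d) (base_state GG) I; rewrite E.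
rewrite [zigzag _ _]/= !act_eltM // E act_elt_vgen // act_elt_egen // /act_left /=.
have [|q [s [qe ->]]] := @act_edge_grow GG e (vin (b (bar e)) * p) L.
  by move=> [/(eimage_mulr pe) /b_notin].
by exists q, ((e, s) :: L); rewrite /= sL; split=> //; exists s, L.
Qed.

(** The inverse of a zigzag word is again without backtracking; only its last
    edge bar e could cancel with the beginning of the normal form it acts on,
    and the second hypothesis excludes this. *)
Lemma zigzag_inv_size e d (S : state GG) : valid S.2 ->
  ~ (eimage e S.1 /\ ohead (unzip1 S.2) = Some e) ->
  size (act_elt (zigzag e d)^-1 S).2 = (size S.2 + d)%N.
Proof.
elim: d e S => [|d IH] e [p L] vS nS; first by rewrite invg1 act_elt1 ?addn0.
rewrite /= invgM invgM act_eltM // -vgenV -egenV act_eltM // act_elt_egen //.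
have [|q [s [qe E]]] := @act_edge_grow GG (bar e) p L; first by rewrite barK.
have vE : valid (act_edge (bar e) (p, L)).2 by exact: act_edge_valid.
rewrite act_elt_vgen // IH ?E ?addSnnS //=; first by rewrite E in vE.
by move=> [/(eimage_mulr qe)/eimageV]; rewrite vinV invgK => /b_notin.
Qed.

End Zigzag.

(** * The zigzag ray and its end *)

Section ZigzagRay.
Variables (GG : graph_of_groups) (b : forall e : edge GG, vgroup (orig e)).
Hypothesis b_notin : forall e, ~ eimage e (vin (b e)).
Variable f : edge GG.

Let v := orig f.

Lemma zigzag_vertexP k :
  `[< is_bs_vertex v (coset (orig (iter k bar f)) (zigzag b f k)) >].
Proof.
by apply/asboolP; do 2 eexists; split; [exact: path_set_zigzag|].
Qed.

Definition zigzag_vertex k : bs_vertex v :=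
  exist (fun A => `[< is_bs_vertex v A >]) _ (zigzag_vertexP k).

Lemma zigzag_vertex_mem k : val (zigzag_vertex k) (zigzag b f k).
Proof. exact: coset_refl. Qed.

Lemma zigzag_div i d :
  (zigzag b f i)^-1 * zigzag b f (i + d) = zigzag b (iter i bar f) d.
Proof. by rewrite zigzagD mulKg. Qed.

Lemma zigzag_geodesic : geodesic_ray (@bs_adj GG v) zigzag_vertex.
Proof.
split=> [k|i j n ij /walk_size].
  exists (iter k bar f), (zigzag b f k), (zigzag b f k.+1); split=> //.
  - exact: path_set_zigzag.
  - by rewrite term_bar; exact: (path_set_zigzag b f k.+1).
  - by rewrite term_bar.
  have [h [_ hE]] :=
    vin_transport (b (bar (iter k bar f))) (esym (term_bar (iter k bar f))).
  by exists 1, h; rewrite -addn1 zigzag_div /= hE vgen1 mul1g mulg1.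
move=> /(_ _ _ (base_state GG) (zigzag_vertex_mem i) (zigzag_vertex_mem j) I).
have [p [L [E sL _ _]]] := zigzag_state b_notin (iter i bar f) (j - i).
by rewrite -{1}(subnKC ij) zigzag_div E /= sL.
Qed.

Definition zigzag_ray : ray (@bs_adj GG v) :=
  exist (fun r => `[< geodesic_ray (@bs_adj GG v) r >]) zigzag_vertex
    (introT (asboolP _) zigzag_geodesic).

(** Since x has no letter f or bar f, it cannot cancel the first f of the zigzag
    word on its right. The result begins with an edge other than f, unless x
    has a normal form without edges; then x lies in G_v outside the image of
    G_f, and the head leaves this image. In both cases the letter bar f on the
    left of x does not cancel. *)
Lemma zigzag_move_size (x : path_group GG) m n :
  path_set v v x ->
  {in word_edges (repr x), forall e, (e != f) && (bar e != f)} ->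
  (forall k : vgroup v, x = vgen k -> ~ eimage f (vin k)) ->
  (0 < m)%N ->
  (n <= size (act_elt ((zigzag b f n)^-1 * (x * zigzag b f m))%g
                      (base_state GG)).2)%N.
Proof.
move=> xP xf xk m0; rewrite !act_eltM //.
have [p [L [E _ pf /(_ m0)[s [L' LE]]]]] := zigzag_state b_notin f m.
have vL : valid L.
  by have := @act_elt_valid _ (zigzag b f m) (base_state GG) I; rewrite E.
rewrite {}E {L}LE in vL *.
have [xE fx] := act_word_cat s L' p xf (isT : f \notin unzip1 [::]).
rewrite zigzag_inv_size ?leq_addl //.
rewrite [act_elt x _]xE -/(act_elt x (p, [::])) /=.
case E: (act_elt x (p, [::])) => [q [|[e t] L]] /= [qf].
  move=> _; have [_ [c [pE _]]] := pf; rewrite pE in E.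
  have [|k kE] := loop_vgen xP (k := alpha f c); first by rewrite E.
  apply: (xk k kE); apply: (eimage_mulr pf).
  by move: E; rewrite kE act_elt_vgen // /act_left /= -pE => -[->].
by move: fx; rewrite -/(act_elt x _) E /= inE negb_or => /andP[/eqP fe _] [/esym].
Qed.

(** Rays with the same end agree after a shift, so a fixed end would place
    x_n^-1 x x_m in a vertex group, where the length is 0. *)
Lemma zigzag_moves (x : pi1 v) :
  {in word_edges (repr (val x)), forall e, (e != f) && (bar e != f)} ->
  (forall k : vgroup v, val x = vgen k -> ~ eimage f (vin k)) ->
  bs_boundary_act v x (\pi_(bs_boundary v)%qT zigzag_ray) <>
    \pi_(bs_boundary v)%qT zigzag_ray.
Proof.
move=> xf xk; rewrite /= boundary_funE => /eqmodP/asboolP[m [n /(_ 1%N) /= E]].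
have xP : path_set v v (val x) by apply/asboolP; exact: (valP x).
have nx : val (zigzag_vertex (n + 1)) (val x * zigzag b f (m + 1)).
  by rewrite -E /=; exists (zigzag b f (m + 1)) => //; exact: coset_refl.
have [u [g gE]] := bs_vertex_div (zigzag_vertex_mem _) nx.
have := zigzag_move_size (n + 1) xP xf xk (_ : 0 < m + 1)%N.
by rewrite gE act_elt_vgen // !addn1 => /(_ isT).
Qed.

End ZigzagRay.

(** If the image of G_e were the whole vertex group, 1 would represent the only
    coset. *)
Lemma coset_reps_ge2 (GG : graph_of_groups) (e : edge GG)
    (Sigma : set (vgroup (orig e))) :
  coset_reps Sigma -> `I_2 #<= Sigma ->
  exists g : vgroup (orig e), ~ eimage e (vin g).
Proof.
move=> [Sigma1 SigmaU] Sigma2; apply: contrapT => /forallNP all_in.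
suff : Sigma `<=` [set 1].
  move=> /subset_card_le /(card_le_trans Sigma2).
  by rewrite (card_le_eqr card_set1) card_le_II.
move=> s Ss /=; have [t [_ tU]] := SigmaU s.
have inr g : range (alpha e) g.
  have /contrapT[_ [c [/vin_inj -> _]]] := all_in g; by exists c.
by rewrite -(tU s) ?(tU 1).
Qed.

Theorem proposition6p6 (GG : graph_of_groups)
  (Sigma : forall e : edge GG, set (vgroup (orig e)))
  (Sigma_reps : forall e : edge GG, coset_reps (Sigma e))
  (Sigma_ge2 : forall e : edge GG, `I_2 #<= Sigma e)
  (v : vertex GG)
  (v_infinite : exists e_ : nat -> edge GG,
    injective e_ /\ forall i, orig (e_ i) = v)
  (v_escape : forall (F : set (vgroup v)) (E : set (edge GG)),
    finite_set F -> F `<=` [set~ 1] ->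
    finite_set E -> E `<=` [set e | orig e = v] ->
    exists f : edge GG,
      [/\ orig f = v, ~ E f & forall g, F g -> ~ in_edge_image f g]) :
  strongly_faithful (bs_boundary_act v).
Proof.
move=> F finF F1.
have b_ex e := cid (coset_reps_ge2 (Sigma_reps e) (Sigma_ge2 e)).
pose b e := projT1 (b_ex e).
have b_notin e : ~ eimage e (vin (b e)) := projT2 (b_ex e).
pose Fv := [set k : vgroup v | (val @` F) (vgen k)].
(* An occurrence of f or of bar f could cancel against the zigzag word. *)
pose edges (x : pi1 v) :=
  word_edges (repr (val x)) ++ map bar (word_edges (repr (val x))).
pose E := [set e : edge GG | orig e = v /\ (\bigcup_(x in F) [set` edges x]) e].
have finFv : finite_set Fv.
  apply: card_le_finite (finite_image val finF).
  by apply: card_ge_preimage => g h _ _; exact: vgen_inj.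
have Fv1 : Fv `<=` [set~ 1].
  move=> k [x Fx xk] k1; apply: (F1 x Fx); apply: val_inj.
  by rewrite xk k1 vgen1.
have finE : finite_set E.
  apply: (@sub_finite_set _ _ (\bigcup_(x in F) [set` edges x])).
    by move=> e [].
  by apply: bigcup_finite => // x _; exact: finite_seq.
have [f [fv fE fF]] := v_escape Fv E finFv Fv1 finE (fun e => @proj1 _ _).
subst v; exists (\pi_(bs_boundary (orig f))%qT (zigzag_ray b_notin f)) => x Fx.
apply: zigzag_moves => [e ex|k xk].
  have fx : f \notin edges x by apply/negP => fx; apply: fE; split=> //; exists x.
  rewrite mem_cat negb_or in fx; have /andP[fx1 fx2] := fx.
  apply/andP; split; apply/eqP => ef.
    by move: ex; rewrite ef; exact/negP.
  by move: (map_f bar ex); rewrite ef; exact/negP.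
move=> /(@eimage_in_edge_image GG f (orig f) k erefl); apply: fF.
by exists x.
Qed.
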